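(* Let $G$ be a finite group and suppose that there exists an integer $d \geq 2$ satisfying $d \mid \deg \varphi$ for all $\varphi \in \widehat{G} \setminus \overline{G}$. If $|G|$ is odd or $d$ is even, then $S(G)_{\rm prime} \subset S(G/G')$.
   Context: For a finite group $G$, let $x_{g}$ be a variable for each $g \in G$. The group determinant of $G$ is $\Theta_{G}(x_{g}) := \det (x_{g h^{-1}})_{g, h \in G} \in \mathbb{Z}[x_{g}]$, and the set of integer group determinants of $G$ is $S(G) := \{ \Theta_{G}(a_{g}) \mid a_{g} \in \mathbb{Z} \text{ for all } g \in G \}$. Put $S(G)_{\rm prime} := \{ m \in S(G) \mid m \text{ is a prime} \}$ (primes are positive). $G'$ denotes the commutator subgroup of $G$, so $G/G'$ is the abelianization of $G$. $\widehat{G}$ denotes a complete set of representatives of the equivalence classes of irreducible representations of $G$ over $\mathbb{C}$, and $\overline{G}$ denotes the set of degree one representations of $G$ over $\mathbb{C}$; thus $\widehat{G} \setminus \overline{G}$ consists of the irreducible representations in $\widehat{G}$ of degree greater than one. $\deg \varphi$ is the degree (dimension) of $\varphi$. *)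

(* Defs.v *)
From mathcomp Require Import all_boot all_order all_algebra all_fingroup.
From mathcomp Require Import all_solvable all_character.
From mathcomp Require Import classical_sets reals complex.

Set Implicit Arguments.
Unset Strict Implicit.
Unset Printing Implicit Defensive.

Import GRing.Theory.

Local Open Scope classical_set_scope.
Local Open Scope ring_scope.

(* G is a subgroup of an ambient finite group type, and its elements are
   listed by [enum_val : 'I_#|G| -> gT].  The family x is defined on all of gT,
   but only its values on G matter. *)
Definition group_det (R : comPzRingType) (gT : finGroupType) (G : {group gT})
    (x : gT -> R) : R :=
  \det (\matrix_(i < #|G|, j < #|G|) x (enum_val i * (enum_val j)^-1)%g).

Definition int_group_dets (gT : finGroupType) (G : {group gT}) : set int :=
  [set m : int | exists a : gT -> int, m = group_det G a].

Definition int_group_dets_prime (gT : finGroupType) (G : {group gT}) :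
    set int :=
  [set m : int | int_group_dets G m /\ exists2 p : nat, prime p & m = p%:Z].

(* Degrees are invariant under equivalence, so quantifying over all irreducible
   representations over the complex numbers R[i] is the same as quantifying
   over a set of representatives of their equivalence classes. *)
Definition dvd_nonlinear_degrees (R : realType) (gT : finGroupType)
    (G : {group gT}) (d : nat) : Prop :=
  forall (n : nat) (phi : mx_representation R[i] G n),
    mx_irreducible phi -> (1 < n)%N -> (d %| n)%N.

(* Main.v *)
Require Import Defs.
From HB Require Import structures.
From mathcomp Require Import all_boot all_order all_algebra all_fingroup.
From mathcomp Require Import all_solvable all_field all_character.
From mathcomp Require Import classical_sets reals complex.
From mathcomp Require Import zify ring.

(** Let f_phi be the characteristic polynomial of phi(a) = sum_g a_g phi(g).
    The regular representation of G contains each irreducible phi exactly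
    deg phi times, so the matrix (a_{g h^-1}) has characteristic polynomial
    P1 = prod_phi f_phi ^ deg phi.  Those phi with G' in their kernel are the
    ones of degree one, and they make up the regular representation of G / G';
    hence their part of the product is the characteristic polynomial P2 of the
    group matrix of G / G' at the coset sums b of a
    ([char_poly_group_matrix_quo]).  All other degrees are multiples of d, so
    P1 = P2 * Q ^ d with Q monic over the algebraic numbers.

    The point is that Q(0) is a rational integer, although the individual f_phi
    need not be rational.  Since P1 and P2 have integer coefficients, Q ^ d has
    rational ones, and a monic polynomial is determined by its d-th power
    through a recurrence with rational coefficients, so that Q is rational too
    ([polyOver_root_exp]); moreover Q(0) is up to sign a product of roots of
    the monic integer polynomial P1, hence an algebraic integer.  Taking -a
    for a and evaluating at 0 gives Theta_G(a) = Theta_{G/G'}(b) * e ^ d with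
    e an integer ([group_det_factor]).

    When the left-hand side is a prime, d >= 2 forces e = 1 or e = -1, and
    Theta_G(a) is Theta_{G/G'}(b) up to sign.  The sign is + when d is even,
    and when |G| is odd it is absorbed by replacing b with -b.

    The degrees used here are those of the representations over the algebraic
    numbers, whereas the divisibility is assumed over the complex numbers.  An
    irreducible representation over the algebraic numbers is realized over a
    number field, and this field embeds into the complex numbers
    ([irreducible_repr_transfer]). *)

Set Implicit Arguments.
Unset Strict Implicit.
Unset Printing Implicit Defensive.

Import Order.TTheory GRing.Theory Num.Theory.
Local Open Scope ring_scope.

(** * Roots of rational monic polynomials *)

(** Writing P = Q ^ d, one has X P' Q = d P X Q'.  In degree deg P + j this
    identity expresses (deg P - d j) Q_j through the Q_k with k > j, and
    deg P - d j is nonzero for j < deg Q; so the coefficients of Q are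
    determined from the top one downwards, rationally in those of P. *)
Lemma polyOver_root_exp (F : numFieldType) (S : divringClosed F) (d : nat)
    (Q : {poly F}) :
  (0 < d)%N -> Q \is monic -> Q ^+ d \is a polyOver S -> Q \is a polyOver S.
Proof.
move=> d_gt0 monQ; set P := Q ^+ d => /polyOverP SP.
set m := (size Q).-1; pose N := (m * d)%N.
have szQ : size Q = m.+1 by rewrite prednK // size_poly_gt0 monic_neq0.
have szP : size P = N.+1.
  rewrite -(prednK (_ : 0 < size P)%N) ?size_exp //.
  by rewrite size_poly_gt0 expf_neq0 ?monic_neq0.
have PN : P`_N = 1.
  have /monicP : P \is monic by rewrite monic_exp.
  by rewrite /lead_coef szP.
(* Euler operator X d/dX: it keeps degrees, so that no index is shifted. *)
have ode : ('X * P^`()) * Q = (P * ('X * Q^`())) *+ d.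
  rewrite /P deriv_exp mulrnAr mulrnAl; congr (_ *+ _).
  by rewrite -(prednK d_gt0) exprS /=; ring.
have coefXderiv (p : {poly F}) i : ('X * p^`())`_i = p`_i *+ i.
  by case: i => [|i]; rewrite coefXM ?mulr0n // coef_deriv.
suffices SQ k j : (m <= j + k)%N -> Q`_j \in S.
  by apply/polyOverP=> j; apply: (SQ m); apply: leq_addl.
elim: k j => [|k IHk] j le_m_jk.
  rewrite addn0 leq_eqVlt in le_m_jk; case/orP: le_m_jk => [/eqP <-|lt_mj].
    by have := monicP monQ; rewrite /lead_coef -/m => ->; apply: rpred1.
  by rewrite nth_default ?rpred0 // szQ.
have [le_mj|lt_jm] := leqP m j.
  by apply: IHk; rewrite (leq_trans le_mj) ?leq_addr.
have /(congr1 (fun p : {poly F} => p`_(N + j))) := ode.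
rewrite coefMn !coefM -sumrMnl => /eqP; rewrite -subr_eq0 -sumrB => /eqP.
have ltN : (N < (N + j).+1)%N by rewrite ltnS leq_addr.
rewrite (bigD1 (Ordinal ltN)) //= !coefXderiv PN mul1r addKn.
move/eqP; rewrite mulrC addr_eq0 => /eqP eqQj.
have Sr : Q`_j * N%:R - Q`_j *+ j *+ d \in S.
  rewrite eqQj rpredN rpred_sum // => i; rewrite -val_eqE /= => ne_iN.
  rewrite !coefXderiv mulrnAr mulrnAl.
  have [lt_iN|] := ltnP i N; last first.
    rewrite leq_eqVlt eq_sym (negPf ne_iN) /= => lt_Ni.
    by rewrite nth_default ?szP // !mul0r !mul0rn subr0 rpred0.
  by rewrite rpredB ?rpredMn // rpredM // IHk //; lia.
have nz : N%:R - (j * d)%:R != 0 :> F.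
  by rewrite subr_eq0 eqr_nat /N eqn_pmul2r // gtn_eqF.
rewrite -mulrnA -[Q`_j *+ _]mulr_natr -mulrBr in Sr.
by rewrite -(mulfK nz Q`_j) rpred_div // rpredB ?rpred_nat.
Qed.

(** The quotient of the two integer polynomials is a d-th power with rational
    coefficients, so Q(0) is rational; it is also an algebraic integer, being
    up to sign the product of the roots of Q, which are roots of p1. *)
Lemma coef0_monic_mul_exp (p1 p2 : {poly int}) (Q : {poly algC}) (d : nat) :
    (0 < d)%N -> p1 \is monic -> p2 \is monic -> Q \is monic ->
    map_poly intr p1 = map_poly intr p2 * Q ^+ d ->
  exists e : int, p1`_0 = p2`_0 * e ^+ d.
Proof.
move=> d_gt0 mon1 mon2 monQ p1E.
have ratE (p : {poly int}) :
    map_poly intr p = map_poly (ratr : rat -> algC) (map_poly intr p).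
  by rewrite -map_poly_comp; apply: eq_map_poly => z /=; rewrite ratr_int.
have ratQd : Q ^+ d \is a polyOver Crat.
  have -> : Q ^+ d = map_poly intr p1 %/ map_poly intr p2.
    by rewrite p1E mulrC mulpK // monic_neq0 ?monic_map.
  rewrite !ratE -map_divp; apply/polyOverP=> i.
  by rewrite coef_map; apply: Crat_rat.
have /polyOverP/(_ 0%N) ratQ0 := polyOver_root_exp d_gt0 monQ ratQd.
have intQ0 : Q`_0 \in Num.int.
  apply: Cint_rat_Aint => //; have [r DQ] := closed_field_poly_normal Q.
  rewrite (monicP monQ) scale1r in DQ.
  rewrite -horner_coef0 DQ horner_prod big_seq rpred_prod // => z r_z.
  rewrite !hornerE rpredN.
  apply: (@root_monic_Aint (map_poly intr p1)).
  - rewrite p1E rootM -(prednK d_gt0) exprS rootM DQ.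
    by rewrite root_prod_XsubC r_z orbT.
  - by rewrite monic_map.
  by apply/polyOverP=> i; rewrite coef_map /=; apply: rpred_int.
have /intrP[e De] := intQ0; exists e.
apply: (@intr_inj algC); rewrite rmorphM rmorphXn /= -De.
by rewrite -!coef_map -!horner_coef0 /= p1E hornerM horner_exp.
Qed.

(** * Descent of irreducible representations *)

(** K is generated over the rationals by one element w; sending w to a root
    in F of the minimal polynomial of w gives the embedding. *)
Lemma number_field_embedding (K : fieldExtType rat) (F : numClosedFieldType) :
  inhabited {rmorphism K -> F}.
Proof.
have sepK : separable 1 {:K}.
  apply/separableP=> u _; apply: pcharf0_separable => i.
  by rewrite pchar_lalg pchar_num.
pose w := separable_generator 1 {:K}.
have genw x : exists p : {poly rat}, x = (map_poly (in_alg K) p).[w].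
  apply/Fadjoin1_polyP.
  by rewrite -(eq_adjoin_separable_generator sepK (sub1v _)) memvf.
have [m Dm] := polyOver1P (minPolyOver 1 w).
have : size (map_poly (ratr : rat -> F) m) != 1.
  by rewrite size_map_poly -(size_map_poly (in_alg K)) -Dm size_minPoly.
case/closed_rootP=> z mz0.
have zP (p : {poly rat}) : (map_poly (in_alg K) p).[w] = 0 ->
    (map_poly (ratr : rat -> F) p).[z] = 0.
  move=> /rootP pw0; have : m %| p.
    rewrite -(dvdp_map (in_alg K)) -Dm minPoly_dvdp //.
    by apply/polyOver1P; exists p.
  by case/dvdpP=> r ->; rewrite rmorphM hornerM (rootP mz0) mulr0.
have /all_tag[q qP] x := sig_eqW (genw x).
pose f x := (map_poly (ratr : rat -> F) (q x)).[z].
(* By the choice of z, f x does not depend on the polynomial representing x. *)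
have fE (p : {poly rat}) x : x = (map_poly (in_alg K) p).[w] ->
    f x = (map_poly (ratr : rat -> F) p).[z].
  move=> Dx; apply/eqP; rewrite -subr_eq0 -hornerN -hornerD -rmorphB /=.
  by rewrite zP // rmorphB /= hornerD hornerN -qP Dx subrr.
have f_add : zmod_morphism f.
  move=> x y; rewrite (fE (q x - q y)) ?rmorphB /= ?hornerD ?hornerN //.
  by rewrite -!qP.
have f_mul : monoid_morphism f.
  split; first by rewrite (fE 1) ?rmorph1 ?hornerC.
  move=> x y; rewrite (fE (q x * q y)) ?rmorphM /= ?hornerM //.
  by rewrite -!qP.
pose fA := GRing.isZmodMorphism.Build K F f f_add.
pose fM := GRing.isMonoidMorphism.Build K F f f_mul.
by constructor; exact: (HB.pack_for {rmorphism K -> F} f fA fM).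
Qed.

Lemma repr_descent (K L : fieldType) (f : {rmorphism K -> L})
    (gT : finGroupType) (G : {group gT}) (n : nat)
    (rG : mx_representation L G n) :
  (forall g i j, exists u, rG g i j = f u) ->
  exists rK : mx_representation K G n, mx_rsim (map_repr f rK) rG.
Proof.
move=> f_rG.
have /all_tag[y yP] (t : gT * ('I_n * 'I_n)) :
    {u : K | rG t.1 t.2.1 t.2.2 = f u} by apply/sig_eqW/f_rG.
pose psi g : 'M[K]_n := \matrix_(i, j) y (g, (i, j)).
have psiE g : map_mx f (psi g) = rG g.
  by apply/matrixP=> i j; rewrite !mxE -yP.
have psi_repr : mx_repr G psi.
  split=> [|g h Gg Gh]; apply: (map_mx_inj (f := f)).
    by rewrite psiE map_mx1 repr_mx1.
  by rewrite map_mxM !psiE repr_mxM.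
exists (MxRepresentation psi_repr); exists 1%:M => // [|g Gg].
  by rewrite row_free_unit unitmx1.
by rewrite mulmx1 mul1mx; apply: psiE.
Qed.

(** The entries of the matrices of rG generate a number field K, and rG is the
    extension of scalars of a representation over K.  As algC is algebraically
    closed, the latter is absolutely irreducible, a property that does not
    change under extension of scalars and that therefore holds over F. *)
Lemma irreducible_repr_transfer (F : numClosedFieldType) (gT : finGroupType)
    (G : {group gT}) (n : nat) (rG : mx_representation algC G n) :
  mx_irreducible rG ->
  exists phi : mx_representation F G n, mx_irreducible phi.
Proof.
move=> irrG.
have [K [KC [s1 Ds1 _]]] :=
  num_field_exists [seq rG t.1 t.2.1 t.2.2 | t : (gT * ('I_n * 'I_n))%type].
have [g i j|rK rsimK] := @repr_descent K algC KC gT G n rG.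
  have : rG g i j \in map KC s1.
    by rewrite Ds1; apply/mapP; exists (g, (i, j)); rewrite ?mem_enum.
  by case/mapP=> u _ ->; exists u.
have [f] := number_field_embedding K F.
exists (map_repr f rK); apply: mx_abs_irrW.
rewrite map_mx_abs_irr -(map_mx_abs_irr KC) (mx_rsim_abs_irr rsimK).
exact: groupC.
Qed.

(** * Characteristic polynomials of elements of the group algebra *)

Lemma char_poly_intertwine (F : fieldType) n (A A' B : 'M[F]_n) :
  B \in unitmx -> A *m B = B *m A' -> char_poly A = char_poly A'.
Proof.
move=> unitB eqAB; set pB := map_mx (@polyC F) B.
have nz_detB : \det pB != 0.
  by rewrite det_map_mx polyC_eq0 -unitfE -unitmxE.
apply: (mulIf nz_detB); rewrite [RHS]mulrC -!det_mulmx; congr (\det _).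
by rewrite mulmxBl mulmxBr scalar_mxC -!map_mxM eqAB.
Qed.

Section GroupAlgebra.
Variables (gT : finGroupType) (G : {group gT}).
Implicit Types (F : fieldType) (n : nat).

Definition gring_act F n (c : gT -> F) (rG : mx_representation F G n) : 'M_n :=
  \sum_(g in G) c g *: rG g.

Lemma char_poly_rsim F (c : gT -> F) n1 n2 (rG1 : mx_representation F G n1)
    (rG2 : mx_representation F G n2) :
  mx_rsim rG1 rG2 -> char_poly (gring_act c rG1) = char_poly (gring_act c rG2).
Proof.
case=> B def_n1; rewrite def_n1 in rG1 B *; rewrite row_free_unit => injB homB.
apply: (char_poly_intertwine injB).
rewrite /gring_act mulmx_suml mulmx_sumr; apply: eq_bigr => g Gg.
by rewrite -scalemxAl -scalemxAr homB.
Qed.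

Lemma char_poly_dsum F (c : gT -> F) (I : Type) (r : seq I)
    (rho : I -> representation F G) :
  char_poly (gring_act c (\big[dadd_grepr/grepr0]_(i <- r) rho i)) =
    \prod_(i <- r) char_poly (gring_act c (rho i)).
Proof.
elim: r => [|i r IHr]; first by rewrite !big_nil /char_poly det_mx00.
rewrite !big_cons -IHr /=; set rho' := \big[_/_]_(_ <- r) _.
have -> : gring_act c (dadd_grepr (rho i) rho') =
    block_mx (gring_act c (rho i)) 0 0 (gring_act c rho').
  rewrite /gring_act; elim/big_rec3: _ => [|g A B C _ ->].
    by rewrite block_mx_const.
  by rewrite scale_block_mx add_block_mx !scaler0 !addr0.
by rewrite /char_poly char_block_diag_mx det_ublock.
Qed.

(** Over algC a representation is determined up to similarity by its
    character, hence it is similar to the direct sum of m i copies of the i-th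
    irreducible representation. *)
Lemma char_poly_decomp (c : gT -> algC) n (rG : mx_representation algC G n)
    (m : Iirr G -> nat) :
  cfRepr rG = \sum_i 'chi_i *+ m i ->
  char_poly (gring_act c rG) =
    \prod_i char_poly (gring_act c 'Chi_i) ^+ m i.
Proof.
move=> DrG.
pose rho := \big[dadd_grepr/grepr0]_i muln_grepr (Representation 'Chi_i) (m i).
have /cfRepr_rsimP/(char_poly_rsim c)-> : cfRepr rG == cfRepr rho.
  rewrite DrG cfRepr_dsum; apply/eqP/eq_bigr=> i _.
  by rewrite cfRepr_muln irrRepr.
rewrite char_poly_dsum; apply: eq_bigr => i _.
by rewrite /muln_grepr char_poly_dsum /= prodr_const card_ord.
Qed.

(** The group matrix describes left multiplication and [regular_repr] describes
    right multiplication; the permutation matrix of the inversion of G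
    conjugates one into the other. *)
Lemma char_poly_group_matrix F (c : gT -> F) :
  char_poly (\matrix_(i < #|G|, j < #|G|)
               c (enum_val i * (enum_val j)^-1)%g) =
  char_poly (gring_act c (regular_repr F G)).
Proof.
pose s (i : 'I_#|G|) : 'I_#|G| := gring_index G (enum_val i)^-1%g.
have sE i : enum_val (s i) = (enum_val i)^-1%g.
  by rewrite gring_indexK // groupV enum_valP.
have sK : involutive s by move=> i; apply: enum_val_inj; rewrite !sE invgK.
pose p := perm (inv_inj sK).
have pV : p = p^-1%g.
  by apply/permP=> i; apply: (canRL (permK _)); rewrite !permE.
apply: (@char_poly_intertwine _ _ _ _ (perm_mx p)); first exact: unitmx_perm.
rewrite -row_permE {1}pV -col_permE; apply/matrixP=> i j.
rewrite !mxE !permE sE invgK summxE.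
rewrite (bigD1 (enum_val i * enum_val j)%g) ?groupM ?enum_valP //=.
rewrite !mxE eqxx /= sE mulKg gring_valK eqxx mulr1 big1 ?addr0 // => g.
case/andP=> Gg ne_g; rewrite !mxE eqxx /= sE.
case: eqP => [Dj|]; rewrite ?mulr0 //.
by rewrite Dj gring_indexK ?groupM ?groupV ?enum_valP // mulKVg eqxx in ne_g.
Qed.

Definition coset_sum (V : nmodType) (H : {group gT}) (c : gT -> V)
    (C : coset_of H) : V :=
  \sum_(g in G | coset H g == C) c g.

Lemma gring_act_quo F (H : {group gT}) (nHG : G \subset 'N(H)%g) n
    (c : gT -> F) (rH : mx_representation F (G / H)%g n) :
  gring_act c (morphim_repr rH nHG) =
    \sum_(C in (G / H)%g) coset_sum c C *: rH C.
Proof.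
rewrite /gring_act (partition_big (coset H) (mem (G / H)%g)) /=; last first.
  by move=> g Gg; apply: mem_quotient.
apply: eq_bigr => C _; rewrite scaler_suml.
by apply: eq_bigr => g /andP[_ /eqP <-].
Qed.

Lemma cfReg_mod (H : {group gT}) : (H <| G)%g ->
  (cfReg (G / H) %% H)%CF =
    \sum_(i | H \subset cfker 'chi[G]_i) 'chi_i 1%g *: 'chi_i.
Proof.
move=> nsHG; rewrite cfReg_sum rmorph_sum (reindex _ (mod_Iirr_bij nsHG)) /=.
apply: eq_big => [i|i _]; first by rewrite mod_IirrE ?cfker_mod.
by rewrite mod_IirrE // linearZ cfModE // morph1.
Qed.

Lemma char_poly_group_matrix_reg (c : gT -> algC) :
  char_poly (\matrix_(i < #|G|, j < #|G|)
               c (enum_val i * (enum_val j)^-1)%g) =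
    \prod_(i : Iirr G)
      char_poly (gring_act c 'Chi_i) ^+ irr_degree (socle_of_Iirr i).
Proof.
rewrite char_poly_group_matrix; apply: char_poly_decomp.
rewrite cfReprReg cfReg_sum; apply: eq_bigr => i _.
by rewrite irr1_degree scaler_nat.
Qed.

End GroupAlgebra.

(** The regular representation of G / H, seen as a representation of G, is the
    sum of those irreducible representations of G whose kernel contains H, each
    repeated as often as its degree ([cfReg_mod]). *)
Lemma char_poly_group_matrix_quo (gT : finGroupType) (G H : {group gT})
    (c : gT -> algC) :
  (H <| G)%g ->
  char_poly (\matrix_(i < #|(G / H)%g|, j < #|(G / H)%g|)
               coset_sum G c (enum_val i * (enum_val j)^-1)%g) =
    \prod_(i | H \subset cfker 'chi[G]_i)
      char_poly (gring_act c 'Chi_i) ^+ irr_degree (socle_of_Iirr i).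
Proof.
move=> nsHG; have nHG := normal_norm nsHG.
rewrite char_poly_group_matrix /gring_act -(gring_act_quo nHG) big_mkcond /=.
pose m i :=
  if H \subset cfker 'chi[G]_i then irr_degree (socle_of_Iirr i) else 0%N.
rewrite (@char_poly_decomp _ _ _ _ _ m).
  by apply: eq_bigr => i _; rewrite /m; case: ifP.
transitivity (cfReg (G / H) %% H)%CF; first by rewrite cfRepr_morphim cfReprReg.
rewrite cfReg_mod // big_mkcond; apply: eq_bigr => i _; rewrite /m.
by case: ifP => _; rewrite ?mulr0n // irr1_degree scaler_nat.
Qed.

(** * Integer group determinants *)

Lemma linear_irr_degree (gT : finGroupType) (G : {group gT}) (i : Iirr G) :
  (G^`(1) \subset cfker 'chi_i)%g = (irr_degree (socle_of_Iirr i) == 1)%N.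
Proof. by rewrite -lin_irr_der1 qualifE /= irr_char irr1_degree pnatr_eq1. Qed.

(** The sign in the argument cancels the one relating the constant coefficient
    of a characteristic polynomial to the determinant. *)
Lemma group_det_char_poly (gT : finGroupType) (G : {group gT})
    (a : gT -> int) :
  group_det G a =
    (char_poly (\matrix_(i < #|G|, j < #|G|)
                 - a (enum_val i * (enum_val j)^-1)%g))`_0.
Proof.
rewrite char_poly_det -detZ /group_det; congr (\det _).
by apply/matrixP=> i j; rewrite !mxE mulN1r opprK.
Qed.

Lemma group_detN (gT : finGroupType) (G : {group gT})
    (a : gT -> int) :
  odd #|G| -> group_det G (fun g => - a g) = - group_det G a.
Proof.
move=> oddG; rewrite -mulN1r -[-1]expr1 -[1%N]/(true : nat) -oddG signr_odd.
rewrite -detZ; congr (\det _).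
by apply/matrixP=> i j; rewrite !mxE mulN1r.
Qed.

(** Here e is the constant coefficient of Q, the product over the nonlinear
    irreducible representations of their characteristic polynomials at -a, each
    with exponent its degree divided by d. *)
Lemma group_det_factor (gT : finGroupType) (G : {group gT}) (d : nat)
    (a : gT -> int) :
    (0 < d)%N ->
    (forall i : Iirr G, (1 < irr_degree (socle_of_Iirr i))%N ->
        (d %| irr_degree (socle_of_Iirr i))%N) ->
  exists e : int,
    group_det G a =
      group_det (G / G^`(1))%G (coset_sum (H := G^`(1)%G) G a) * e ^+ d.
Proof.
move=> d_gt0 dvd_d.
pose n (i : Iirr G) := irr_degree (socle_of_Iirr i).
pose c g : algC := (- a g)%:~R.
pose f (i : Iirr G) := char_poly (gring_act c 'Chi_i).
pose Q := \prod_(i | ~~ (G^`(1) \subset cfker 'chi[G]_i)%g) f i ^+ (n i %/ d).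
rewrite !group_det_char_poly.
apply: (@coef0_monic_mul_exp _ _ Q) => //; try exact: char_poly_monic.
  by apply: monic_prod => i _; rewrite monic_exp // char_poly_monic.
rewrite !map_char_poly.
transitivity (\prod_i f i ^+ n i).
  rewrite -char_poly_group_matrix_reg; congr char_poly.
  by apply/matrixP=> i j; rewrite !mxE.
rewrite (bigID (fun i => G^`(1) \subset cfker 'chi[G]_i)%g) /=.
congr (_ * _).
  rewrite -(char_poly_group_matrix_quo _ (der_normal 1 G)); congr char_poly.
  by apply/matrixP=> i j; rewrite !mxE -sumrN rmorph_sum.
rewrite /Q -prodrXl; apply: eq_bigr => i nonlin_i.
rewrite -exprM divnK // dvd_d // ltn_neqAle irr_degree_gt0 andbT eq_sym.
by rewrite -linear_irr_degree.
Qed.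

Lemma prime_mul_exp (p : nat) (m e : int) (d : nat) :
  (1 < d)%N -> prime p -> p%:Z = m * e ^+ d -> `|e|%N = 1%N.
Proof.
move=> d_gt1 pr_p /(congr1 absz); rewrite abszM abszX /= => Dp.
have /primeP[_ /(_ `|e|%N)] := pr_p.
have -> : (`|e| %| p)%N by rewrite Dp dvdn_mull // dvdn_exp // ltnW.
move/(_ isT)/orP=> [/eqP //|/eqP De].
have : (p ^ 2 %| p)%N by rewrite {2}Dp De dvdn_mull // dvdn_exp2l.
move/(dvdn_leq (prime_gt0 pr_p)); rewrite leqNgt -{1}[p]expn1.
by rewrite ltn_exp2l // prime_gt1.
Qed.

Theorem theorem3 (R : realType) (gT : finGroupType) (G : {group gT}) (d : nat)
    (hd : (2 <= d)%N) (hdvd : dvd_nonlinear_degrees R G d)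
    (hpar : odd #|G| \/ ~~ odd d) :
  (int_group_dets_prime G `<=` int_group_dets (G / G^`(1))%G)%classic.
Proof.
move=> _ [[a ->] [p pr_p Dp]].
have [|e De] := @group_det_factor _ G d a (ltnW hd).
  move=> i; have [phi irr_phi] :=
    irreducible_repr_transfer R[i] (socle_irr (socle_of_Iirr i)).
  exact: hdvd irr_phi.
set b := coset_sum G a in De.
have e1 := prime_mul_exp hd pr_p (etrans (esym Dp) De).
have [e_1|e_N1] : e = 1 \/ e = -1 by lia.
  by exists b; rewrite De e_1 expr1n mulr1.
rewrite e_N1 -signr_odd in De; case: hpar => [oddG|/negPf even_d].
  have oddQ : odd #|(G / G^`(1))%g|.
    by apply: dvdn_odd oddG; apply: dvdn_quotient.
  case: odd De => De; last by exists b; rewrite De mulr1.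
  by exists (fun C => - b C); rewrite group_detN // De mulrN1.
by exists b; rewrite De even_d mulr1.
Qed.
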